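(* Let $0<q<1$, let $\Sigma$ be a random balanced permutation of $\mathbb Z$ distributed according to the Mallows measure $\mathcal Q$ with parameter $q$, and let $D_i=\Sigma(i)-i$ for $i\in\mathbb Z$. For $k=1,2,\dots$ and integers $d_1\le\dots\le d_k$, $$\mathbb P(D_1=d_1,\dots,D_k=d_k)=(1-q)^kq^{-k(k+1)/2}\,\langle\infty\rangle_q\prod_{m=2}^{k}\langle d_m-d_{m-1}\rangle_q\ \sum\frac{q^{\sum_{1\le i\le j\le k}(b_i+1)(a_j+1)}}{\langle b_1\rangle_q\cdots\langle b_k\rangle_q\,\langle a_1\rangle_q\cdots\langle a_k\rangle_q},$$ where the outer summation is over all nonnegative integers $a_1,b_1,\dots,a_k,b_k$ satisfying the constraints $$(b_1+\dots+b_m)-(a_m+\dots+a_k)=d_m,\qquad m=1,\dots,k.$$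
   Context: Notation: $\langle n\rangle_q=\prod_{k=1}^n(1-q^k)$ for $n=0,1,2,\dots$ (with $\langle0\rangle_q=1$), $\langle\infty\rangle_q=\prod_{k=1}^\infty(1-q^k)$. Empty products equal $1$. $\mathfrak S$ is the group of all bijections of $\mathbb Z$, with the topology of pointwise convergence (for each $i$, $\sigma_n(i)=\sigma(i)$ for all large $n$) and its Borel structure. $\sigma\in\mathfrak S$ is balanced if $\#\{j\ge 1:\sigma(j)\le 0\}=\#\{j\le 0:\sigma(j)\ge 1\}<\infty$; $\mathfrak S^{\mathrm{bal}}$ is the group of balanced permutations. For $i\in\mathbb Z$ let $\sigma_{i,i+1}$ be the transposition swapping $i$ and $i+1$. A measure $\mu$ is right $q$-exchangeable if for every $i\in\mathbb Z$ its pushforward under $\sigma\mapsto\sigma\sigma_{i,i+1}$ is equivalent to $\mu$ with Radon–Nikodým derivative $q^{\mathrm{sgn}(\sigma(i+1)-\sigma(i))}$ at $\sigma$; it is left $q$-exchangeable if for every $i$ its pushforward under $\sigma\mapsto\sigma_{i,i+1}\sigma$ is equivalent to $\mu$ with derivative $q^{\mathrm{sgn}(\sigma^{-1}(i+1)-\sigma^{-1}(i))}$. The Mallows measure $\mathcal Q$ is the unique (existing) Borel probability measure on $\mathfrak S^{\mathrm{bal}}$ that is both right and left $q$-exchangeable. *)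

(* Defs.v *)
From HB Require Import structures.
From mathcomp Require Import all_boot all_order all_algebra.
From mathcomp Require Import all_classical all_reals all_analysis.

Set Implicit Arguments.
Unset Strict Implicit.
Unset Printing Implicit Defensive.

Import Order.TTheory GRing.Theory Num.Theory.
Import numFieldNormedType.Exports.

Local Open Scope classical_set_scope.
Local Open Scope ring_scope.

(* Bijections of Z, with the (uniquely determined) inverse carried as data. *)
Record permZ := PermZ {
  pfun :> int -> int;
  pinv : int -> int;
  pfunK : cancel pfun pinv;
  pinvK : cancel pinv pfun }.

Lemma permZP (s t : permZ) : s =1 t -> s = t.
Proof.
case: s t => [f f' fK f'K] [g g' gK g'K] /= fg.
have efg : f = g by apply/funext.
have efg' : f' = g'.
  by apply/funext => x; rewrite -[in LHS](g'K x) -fg fK.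
subst g g'; congr PermZ; exact: Prop_irrelevance.
Qed.

Definition perm1 : permZ := @PermZ id id (fun=> erefl) (fun=> erefl).

Definition perm_inv (s : permZ) : permZ := PermZ (pinvK s) (pfunK s).

(* Composition of maps: (perm_comp s t) i = s (t i). *)
Definition perm_comp (s t : permZ) : permZ :=
  PermZ (can_comp (pfunK s) (pfunK t)) (can_comp (pinvK t) (pinvK s)).

Definition adj_swap (i j : int) : int :=
  if j == i then i + 1 else if j == i + 1 then i else j.

Lemma adj_swapK i : involutive (adj_swap i).
Proof.
have ni : (i + 1 == i) = false by rewrite -subr_eq0 addrAC subrr add0r.
move=> j; rewrite /adj_swap.
case: (eqVneq j i) => [->|ji]; first by rewrite ni eqxx.
case: (eqVneq j (i + 1)) => [->|ji1]; first by rewrite eqxx.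
by rewrite (negbTE ji) (negbTE ji1).
Qed.

Definition adj_transp (i : int) : permZ := PermZ (adj_swapK i) (adj_swapK i).

HB.instance Definition _ := gen_eqMixin permZ.
HB.instance Definition _ := gen_choiceMixin permZ.
HB.instance Definition _ := isPointed.Build permZ perm1.

Definition ptws_of_permZ (s : permZ) : {ptws int -> discrete_topology int} := s.

HB.instance Definition _ :=
  Topological.copy permZ (initial_topology ptws_of_permZ).

HB.instance Definition _ :=
  Measurable.copy permZ (g_sigma_algebraType (@open permZ)).

Definition balanced : set permZ := [set s |
  let A := [set j : int | 1 <= j /\ s j <= 0] in
  let B := [set j : int | j <= 0 /\ 1 <= s j] in
  finite_set A /\ (A #= B)%card].

Definition equivalent_with_density d (T : measurableType d) (R : realType)
    (mu nu : set T -> \bar R) (f : T -> R) :=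
  [/\ nu `<< mu, mu `<< nu &
    forall B, measurable B -> nu B = (\int[mu]_(x in B) (f x)%:E)%E].

Definition right_exchangeable (R : realType) (q : R)
    (mu : set permZ -> \bar R) :=
  forall i : int, equivalent_with_density mu
    (pushforward mu (fun s : permZ => perm_comp s (adj_transp i)))
    (fun s => q ^ Num.sg (s (i + 1) - s i)).

Definition left_exchangeable (R : realType) (q : R)
    (mu : set permZ -> \bar R) :=
  forall i : int, equivalent_with_density mu
    (pushforward mu (fun s : permZ => perm_comp (adj_transp i) s))
    (fun s => q ^ Num.sg (perm_inv s (i + 1) - perm_inv s i)).

(* A Borel probability measure on the balanced permutations is regarded as one
   on all of permZ for which the balanced permutations have full measure. *)
Definition Mallows (R : realType) (q : R) (Q : probability permZ R) :=
  [/\ Q balanced = 1%E, right_exchangeable q Q & left_exchangeable q Q].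

Definition displacement (s : permZ) (i : int) : int := s i - i.

Definition qprod (R : realType) (q : R) (n : nat) : R :=
  \prod_(1 <= j < n.+1) (1 - q ^+ j).

Definition qprod_oo (R : realType) (q : R) : R := limn (qprod q).

Section summation.
Variable k : nat.
Implicit Types ab : {ffun 'I_k -> nat} * {ffun 'I_k -> nat}.

(* The index i : 'I_k stands for i + 1 in 1, ..., k. *)

Definition constraint (d : 'I_k -> int) :=
  [set ab : {ffun 'I_k -> nat} * {ffun 'I_k -> nat} | forall m : 'I_k,
    (\sum_(i < k | (i <= m)%N) ab.2 i)%N%:Z
    - (\sum_(i < k | (m <= i)%N) ab.1 i)%N%:Z = d m].

Definition summand (R : realType) (q : R) ab : R :=
  q ^+ (\sum_(i < k) \sum_(j < k | (i <= j)%N) (ab.2 i).+1 * (ab.1 j).+1)%N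
  / ((\prod_(i < k) qprod q (ab.2 i)) * (\prod_(i < k) qprod q (ab.1 i))).

(* The product of <d_m - d_(m-1)> over m = 2, ..., k.  It is used for
   nondecreasing d only, so that the absolute value is harmless. *)
Definition gap_prod (R : realType) (q : R) (d : 'I_k -> int) : R :=
  \prod_(m < k) \prod_(l < k | m == l.+1 :> nat) qprod q `|d m - d l|%N.

End summation.

(* Main.v *)
Require Import Defs.
From mathcomp Require Import all_boot all_order all_algebra finmap.
From mathcomp Require Import all_classical all_reals all_analysis.
From mathcomp Require Import zify ring.

Set Implicit Arguments.
Unset Strict Implicit.
Unset Printing Implicit Defensive.

Import Order.TTheory GRing.Theory Num.Theory.
Import numFieldNormedType.Exports.
Local Open Scope classical_set_scope.
Local Open Scope ring_scope.

(** Write sigma for the random permutation and call sigma^-1(v) the position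
    of the value v.  For the positions 1, ..., k the relevant datum is the word
    obtained by reading, along the values v, whether the position of v is
    nonpositive (letter L), is one of 1, ..., k (the letter itself) or exceeds
    k (letter R).  By left exchangeability, swapping two adjacent values whose
    letters stand in increasing order multiplies the probability by q
    [pr_swap].  So the probability of a word is q^inv times that of the sorted
    word ...LLL 1 2 ... k RRR..., where inv counts inversions; by balancedness
    the letter 1 of a sorted word must stand at the value 1.

    The event that the displacements are d_1 <= ... <= d_k fixes the values
    v_1 < ... < v_k at which the letters 1, ..., k occur.  It splits into cells
    according to the number b_m of letters R in the m-th of the k+1 gaps cut
    out by the v_i and the number a_m of letters L in the next gap; the first
    gap contains finitely many R and the last one finitely many L, almost
    surely.  To find
    the probability of one such cell, read the word from left to right and keep
    the part already read sorted as ...LLL 1 ... m R^y.  Appending an R changes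
    nothing, moving an L to the left costs q^(y+m) [pr_insertL], moving the
    letter m+1 costs q^y [pr_insert_letter].  Reading a gap of n values with b
    letters R therefore costs q^((n-b)(y+m)) times the Gaussian binomial
    coefficient, whose recursion is the case distinction on the last letter
    [pr_block].  The two infinite gaps are monotone limits of finite ones, and
    the Gaussian binomials tend to 1/<b> and 1/<a> [pr_first_block,
    pr_last_block].  The accumulated exponent is
    sum_{i<=j} ((b_i+1)(a_j+1) - 1).

    It remains to compute the probability C_k of the sorted word.  Deciding at
    which value the position k+1 occurs, among the letters R, yields
    C_k = C_(k+1) (1 + q + q^2 + ...), so C_k = (1-q)^k C_0
    [pr_ground_wordS].  For k = 0, the probability that all values <= -N are
    letters L equals C_0/<N> and tends to 1, whence C_0 = <oo>
    [pr_ground_word0].  When the constraints on (a, b) fail, either the cell is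
    empty or the associated sorted word starts at the wrong place, which is
    impossible for a balanced permutation; so the sum over all cells reduces to
    the sum in the statement. *)

(* The bare name [pinv] refers to partial inverses of functions. *)
Local Notation pos := Defs.pinv.

(** * Measurability *)
Lemma countable_bigcup_measurable d (U : measurableType d) (T : countType)
    (D : set T) (F : T -> set U) :
  (forall i, D i -> measurable (F i)) -> measurable (\bigcup_(i in D) F i).
Proof.
move=> mF; rewrite bigcup_mkcond; apply: countable_bigcupT_measurable => // i.
by case: ifPn => // /set_mem; exact: mF.
Qed.

(** Evaluation at p is continuous into the discrete integers, so each
    [s p = v] is open; the general event is a countable union of these. *)
Lemma measurable_eval (phi : int -> Prop) (p : int) :
  measurable [set s : permZ | phi (s p)].
Proof.
have mv v : measurable [set s : permZ | s p = v].
  apply: sub_sigma_algebra.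
  have -> : [set s : permZ | s p = v] =
      ptws_of_permZ @^-1`
        ((fun f : {ptws int -> discrete_topology int} => f p) @^-1` [set v]).
    by [].
  apply: open_comp; first by move=> x _; exact: initial_continuous.
  apply: open_comp; last exact: discrete_open.
  by move=> x _; exact: (@proj_continuous int (fun=> discrete_topology int)).
have -> : [set s : permZ | phi (s p)] =
    \bigcup_(v in [set v | phi v]) [set s : permZ | s p = v].
  by apply/seteqP; split=> [s ps|s [v pv /= ->]//]; exists (s p).
exact: countable_bigcup_measurable.
Qed.

Lemma measurable_pos (phi : int -> Prop) (v : int) :
  measurable [set s : permZ | phi (pos s v)].
Proof.
have -> : [set s : permZ | phi (pos s v)] =
    \bigcup_(p in [set p | phi p]) [set s : permZ | s p = v].
  apply/seteqP; split=> [s ps|s [p pp /= <-]]; last by rewrite Defs.pfunK.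
  by exists (pos s v) => //=; exact: Defs.pinvK.
by apply: countable_bigcup_measurable => p _; exact: (measurable_eval (fun u => u = v)).
Qed.

(** * Exchanging two adjacent values *)
Definition lswap (i : int) (s : permZ) : permZ := perm_comp (adj_transp i) s.

Lemma pos_lswap (i : int) s v : pos (lswap i s) v = pos s (adj_swap i v).
Proof. by []. Qed.

Lemma lswapK i : involutive (lswap i).
Proof. move=> s; apply: permZP => j /=; exact: adj_swapK. Qed.

Definition lswap_invariant (i : int) (A : set permZ) := forall s, A s -> A (lswap i s).

Section prob.
Variables (R : realType) (q : R) (Q : probability permZ R).
Hypothesis exQ : left_exchangeable q Q.

Definition prob (A : set permZ) : R := fine (Q A).
Local Notation pr := prob.

Lemma probE A : measurable A -> Q A = (pr A)%:E.
Proof. by move=> mA; rewrite /prob fineK// fin_num_measure. Qed.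

(** On the event of the right-hand side the density of left exchangeability
    is the constant q, because the value i precedes i + 1 in position. *)
Lemma pr_swap i (X Y : int -> Prop) (G : set permZ) :
  (forall x y, X x -> Y y -> x < y) -> lswap_invariant i G -> measurable G ->
  pr ([set s | Y (pos s i)] `&` [set s | X (pos s (i + 1))] `&` G) =
  q * pr ([set s | X (pos s i)] `&` [set s | Y (pos s (i + 1))] `&` G).
Proof.
move=> XY iG mG.
set B := [set s | X (pos s i)] `&` [set s | Y (pos s (i + 1))] `&` G.
have mB : measurable B.
  by apply: measurableI => //; apply: measurableI; exact: measurable_pos.
have [_ _ /(_ B mB)] := exQ i.
have swi : adj_swap i i = i + 1 by rewrite /adj_swap eqxx.
have swi1 : adj_swap i (i + 1) = i by rewrite -swi adj_swapK.
rewrite /pushforward.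
have -> : (fun s : permZ => perm_comp (adj_transp i) s) @^-1` B =
   [set s | Y (pos s i)] `&` [set s | X (pos s (i + 1))] `&` G.
  apply/seteqP; split=> s.
  - move=> [[/= h1 h2] h3]; rewrite swi in h1; rewrite swi1 in h2.
    by split; [split|move/iG: h3; rewrite lswapK].
  - move=> [[/= h1 h2] h3].
    by split; [split; rewrite /= ?swi ?swi1|exact: iG].
move=> E; apply: EFin_inj; rewrite EFinM -!probE//; last first.
  by apply: measurableI => //; apply: measurableI; exact: measurable_pos.
rewrite E (eq_integral (cst q%:E)).
  by rewrite integral_cst.
move=> s /set_mem [[h1 h2] _] /=.
by rewrite gtr0_sg ?expr1z// subr_gt0; exact: XY.
Qed.

End prob.

(** * Events read off from the positions of given values *)

(** Recording which values an event depends on makes its invariance under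
    exchanges of other values automatic. *)
Definition determined (D : set int) (A : set permZ) :=
  forall s s', (forall v, D v -> pos s v = pos s' v) -> A s -> A s'.

Lemma determinedI D A B :
  determined D A -> determined D B -> determined D (A `&` B).
Proof. by move=> dA dB s s' ss' [As Bs]; split; [exact: dA As|exact: dB Bs]. Qed.

Lemma determinedS D D' A : D `<=` D' -> determined D A -> determined D' A.
Proof. by move=> DD dA s s' ss'; apply: dA => v /DD; exact: ss'. Qed.

Lemma determined_lswap D i A : ~ D i -> ~ D (i + 1) -> determined D A -> lswap_invariant i A.
Proof.
move=> ni ni1 dA s; apply: dA => v Dv.
rewrite pos_lswap /adj_swap; case: eqP => [vi|_]; first by rewrite vi in Dv.
by case: eqP => [vi|_ //]; rewrite vi in Dv.
Qed.

(** * The words formed by the positions *)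
Definition readsL (t : int) : set permZ := [set s | pos s t <= 0].
Definition reads (t : int) (j : nat) : set permZ := [set s | pos s t = j%:Z].
Definition readsR (k : nat) (t : int) : set permZ := [set s | k%:Z < pos s t].

(** The values below t read ...LLL 1 2 ... m; the recursion peels off the last
    letter, which is the one an inserted letter has to pass first. *)
Fixpoint left_word (t : int) (m : nat) : set permZ :=
  if m is m'.+1 then left_word (t - 1) m' `&` reads (t - 1) m
  else [set s | forall v, v < t -> pos s v <= 0].

Fixpoint left_wordR (k : nat) (t : int) (m y : nat) : set permZ :=
  if y is y'.+1 then left_wordR k (t - 1) m y' `&` readsR k (t - 1) else left_word t m.

Definition right_tail (k : nat) (t : int) : set permZ :=
  [set s | forall v, t <= v -> k%:Z < pos s v].

Definition block (k : nat) (t : int) (n b : nat) : set permZ :=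
  [set s | (forall i, (i < n)%N -> pos s (t + i%:Z) <= 0 \/ k%:Z < pos s (t + i%:Z)) /\
    (\sum_(0 <= i < n) (k%:Z < pos s (t + i%:Z))%R = b)%N].

Lemma determined_left_word t m : determined [set v | v < t] (left_word t m).
Proof.
elim: m t => [|m IH] t /=.
  by move=> s s' ss' As v vt; rewrite -ss'//; exact: As.
apply: determinedI; first by apply: determinedS (IH _) => v /=; lia.
by move=> s s' /(_ (t - 1)) ss'; rewrite /reads /= ss'//=; lia.
Qed.

Lemma determined_left_wordR k t m y : determined [set v | v < t] (left_wordR k t m y).
Proof.
elim: y t => [|y IH] t /=; first exact: determined_left_word.
apply: determinedI; first by apply: determinedS (IH _) => v /=; lia.
by move=> s s' /(_ (t - 1)) ss'; rewrite /readsR /= ss'//=; lia.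
Qed.

Lemma determined_right_tail k t : determined [set v | t <= v] (right_tail k t).
Proof. by move=> s s' ss' As v vt; rewrite -ss'//; exact: As. Qed.

Lemma determined_block k t n b :
  determined [set v | t <= v /\ v < t + n%:Z] (block k t n b).
Proof.
have E s s' : (forall v, t <= v /\ v < t + n%:Z -> pos s v = pos s' v) ->
    forall i, (i < n)%N -> pos s (t + i%:Z) = pos s' (t + i%:Z).
  by move=> ss' i ni; apply: ss'; lia.
move=> s s' /E{}E [h1 <-]; split=> [i ni|]; first by rewrite -E//; exact: h1.
by apply: eq_big_nat => i /andP[_ ni]; rewrite E.
Qed.

Lemma measurable_forall (T : countType) (F : T -> set permZ) :
  (forall i, measurable (F i)) -> measurable [set s | forall i, F i s].
Proof.
move=> mF; rewrite -[X in measurable X]setCK; apply: measurableC.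
rewrite (_ : ~` _ = \bigcup_i ~` F i).
  by apply: countable_bigcupT_measurable => // i; exact/measurableC.
apply/seteqP; split=> [s /existsNP[i Fi]|s [i _ Fi] /(_ i)//].
by exists i.
Qed.

Lemma measurable_implies (P : Prop) (F : set permZ) :
  measurable F -> measurable [set s | P -> F s].
Proof.
move=> mF; have [p|np] := pselect P.
  by rewrite (_ : [set _ | _] = F) //; apply/seteqP; split=> s /=; [move=> h; exact: h|].
by rewrite (_ : [set _ | _] = setT) //; apply/seteqP; split=> s //= _ /np.
Qed.

Lemma measurable_left_word t m : measurable (left_word t m).
Proof.
elim: m t => [|m IH] t /=.
  by apply: measurable_forall => v; apply: measurable_implies;
    exact: (measurable_pos (fun p => p <= 0)).
by apply: measurableI => //; exact: measurable_pos (fun p => p = m.+1%:Z) _.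
Qed.

Lemma measurable_reads t j : measurable (reads t j).
Proof. exact: measurable_pos (fun p => p = j%:Z) _. Qed.

Lemma measurable_readsL t : measurable (readsL t).
Proof. exact: measurable_pos (fun p => p <= 0) _. Qed.

Lemma measurable_readsR k t : measurable (readsR k t).
Proof. exact: measurable_pos (fun p => k%:Z < p) _. Qed.

Lemma measurable_left_wordR k t m y : measurable (left_wordR k t m y).
Proof.
elim: y t => [|y IH] t /=; first exact: measurable_left_word.
by apply: measurableI => //; exact: measurable_readsR.
Qed.

Lemma measurable_right_tail k t : measurable (right_tail k t).
Proof.
by apply: measurable_forall => v; apply: measurable_implies; exact: measurable_readsR.
Qed.

Lemma block0 k t b : block k t 0 b = [set s | b = 0%N].
Proof.
apply/seteqP; split=> s; first by case=> _ <-; rewrite big_nil.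
by move=> /= ->; split=> //; rewrite big_nil.
Qed.

Lemma blockS k t n b s : block k t n.+1 b s <->
  (block k t n b `&` readsL (t + n%:Z)) s \/
  exists2 b', b = b'.+1 & (block k t n b' `&` readsR k (t + n%:Z)) s.
Proof.
split=> [[h1]|[[[h1 h2] /= r]|[b' -> [[h1 h2] /= r]]]].
- rewrite big_nat_recr//= => h2.
  have := h1 n (ltnSn n) => -[l|r].
    left; split=> //; split=> [i ni|]; first by apply: h1; exact: ltnW.
    by rewrite -h2 (_ : (_ < _) = false) ?addn0//; lia.
  right; exists (\sum_(0 <= i < n) (k%:Z < pos s (t + i%:Z))%R)%N.
    by rewrite -h2 r addn1.
  by split=> //; split=> // i ni; apply: h1; exact: ltnW.
- split=> [i|].
    by rewrite ltnS leq_eqVlt => /orP[/eqP ->|]; [left|exact: h1].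
  rewrite big_nat_recr//= h2 (_ : (_ < _) = false) ?addn0//; rewrite /readsL /= in r; lia.
- split=> [i|].
    by rewrite ltnS leq_eqVlt => /orP[/eqP ->|]; [right|exact: h1].
  by rewrite big_nat_recr//= h2 r addn1.
Qed.

Lemma measurable_block k t n b : measurable (block k t n b).
Proof.
elim: n b => [|n IH] b.
  by rewrite block0; exact: measurable_pos (fun=> b = 0%N) 0.
case: b => [|b].
  rewrite (_ : block _ _ _ _ = block k t n 0 `&` readsL (t + n%:Z)).
    by apply: measurableI => //; exact: measurable_readsL.
  by apply/seteqP; split=> s /=; rewrite blockS; [case=> // -[]|left].
rewrite (_ : block _ _ _ _ = (block k t n b.+1 `&` readsL (t + n%:Z)) `|`
   (block k t n b `&` readsR k (t + n%:Z))).
  by apply: measurableU; apply: measurableI => //;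
    [exact: measurable_readsL|exact: measurable_readsR].
apply/seteqP; split=> s /=; rewrite blockS; first by case=> [|[b' [<-]]]; [left|right].
by case=> ?; [left|right; exists b].
Qed.

(** Gaussian binomial coefficients, by the recursion that arises when the last
    letter of a block is R (first term) or an L preceded by b letters R. *)
Fixpoint qbin (R : realType) (q : R) (n b : nat) : R :=
  match n, b with
  | _, 0 => 1
  | 0, _.+1 => 0
  | n'.+1, b'.+1 => qbin q n' b' + q ^+ b * qbin q n' b
  end.

(** * Sorting a word costs a power of q *)
Ltac measure_tac := repeat first [done | exact: measurable_left_wordR |
  exact: measurable_left_word | exact: measurable_block | exact: measurable_readsL |
  exact: measurable_readsR | exact: measurable_reads | exact: measurable_right_tail |
  apply: measurableI].

Ltac set_tauto := apply/seteqP; split=> s /=; tauto.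

Section moves.
Variables (R : realType) (q : R) (Q : probability permZ R).
Hypothesis exQ : left_exchangeable q Q.
Local Notation pr := (prob Q).

(** The form in which adjacent letters are exchanged: the earlier part A and
    the later part H of the word do not see the exchange. *)
Lemma pr_swap_word (X Y : int -> Prop) t A H :
  (forall x y, X x -> Y y -> x < y) ->
  measurable A -> determined [set v | v < t - 1] A ->
  measurable H -> determined [set v | t + 1 <= v] H ->
  pr (A `&` [set s | Y (pos s (t - 1))] `&` [set s | X (pos s t)] `&` H) =
  q * pr (A `&` [set s | X (pos s (t - 1))] `&` ([set s | Y (pos s t)] `&` H)).
Proof.
move=> XY mA dA mH dH.
have iAH : lswap_invariant (t - 1) (A `&` H).
  move=> s [h1 h2]; split.
    by apply: (determined_lswap _ _ dA) h1 => /=; lia.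
  by apply: (determined_lswap _ _ dH) h2 => /=; lia.
have := pr_swap exQ XY iAH (measurableI _ _ mA mH); rewrite subrK => e.
transitivity (q * pr ([set s | X (pos s (t - 1))] `&` [set s | Y (pos s t)] `&` (A `&` H))).
  by rewrite -e; congr pr; set_tauto.
by congr (_ * pr _); set_tauto.
Qed.

Lemma determined_and_next t (X : int -> Prop) H :
  determined [set v | t + 1 <= v] H ->
  determined [set v | t <= v] ([set s | X (pos s t)] `&` H).
Proof.
move=> dH; apply: determinedI; last by apply: determinedS dH => v /=; lia.
by move=> s s' /(_ t) ss' /=; rewrite ss'//=.
Qed.

(** An L read at t has to pass y letters R and m letters 1, ..., m. *)
Lemma pr_insertL k t m y H : measurable H -> determined [set v | t + 1 <= v] H ->
  pr (left_wordR k t m y `&` readsL t `&` H) =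
  q ^+ (y + m) * pr (left_wordR k (t + 1) m y `&` H).
Proof.
elim: y t H => [|y IH] t H mH dH /=.
  rewrite add0n; elim: m t H mH dH => [|m IH] t H mH dH /=.
    rewrite mul1r; congr (pr (_ `&` _)); apply/seteqP; split=> s /=.
      move=> [h1 h2] v vt; have [vlt|vge] := ltP v t; first exact: h1.
      by have -> : v = t by lia.
    by move=> h; split=> [v vt|]; apply: h; lia.
  rewrite addrK (pr_swap_word (X := fun p => p <= 0) (Y := fun p => p = m.+1%:Z))//.
  - rewrite (IH _ (reads t m.+1 `&` H)).
    + by rewrite subrK mulrA -exprS setIA.
    + by measure_tac.
    + by rewrite subrK; exact: (determined_and_next (X := fun p => p = m.+1%:Z)).
  - by move=> x y; lia.
  - exact: measurable_left_word.
  - exact: determined_left_word.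
rewrite addrK (pr_swap_word (X := fun p => p <= 0) (Y := fun p => k%:Z < p))//.
- rewrite (IH _ (readsR k t `&` H)).
  + by rewrite subrK mulrA -exprS setIA.
  + by measure_tac.
  + by rewrite subrK; exact: (determined_and_next (X := fun p => k%:Z < p)).
- by move=> x z; lia.
- exact: measurable_left_wordR.
- exact: determined_left_wordR.
Qed.

(** The letter m + 1 stops after passing the y letters R, since it exceeds all
    of 1, ..., m. *)
Lemma pr_insert_letter k t m y H : (m < k)%N -> measurable H ->
  determined [set v | t + 1 <= v] H ->
  pr (left_wordR k t m y `&` reads t m.+1 `&` H) =
  q ^+ y * pr (left_wordR k (t + 1) m.+1 y `&` H).
Proof.
move=> mk; elim: y t H => [|y IH] t H mH dH /=.
  by rewrite mul1r addrK.
rewrite addrK (pr_swap_word (X := fun p => p = m.+1%:Z) (Y := fun p => k%:Z < p))//.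
- rewrite (IH _ (readsR k t `&` H)).
  + by rewrite subrK mulrA -exprS setIA.
  + by measure_tac.
  + by rewrite subrK; exact: (determined_and_next (X := fun p => k%:Z < p)).
- by move=> x z; lia.
- exact: measurable_left_wordR.
- exact: determined_left_wordR.
Qed.

Lemma probU A B : measurable A -> measurable B -> A `&` B = set0 ->
  pr (A `|` B) = pr A + pr B.
Proof.
move=> mA mB AB; apply: EFin_inj; rewrite EFinD -!probE ?measureU//.
exact: measurableU.
Qed.

Lemma qbin_small n b : (n < b)%N -> qbin q n b = 0.
Proof.
elim: n b => [|n IH] [|b]//=; rewrite ltnS => nb.
by rewrite !IH ?mulr0 ?addr0//; exact: ltnW.
Qed.

(** Induction on the length of the block, splitting on its last letter: this
    letter is first treated as a part of H, and once the rest of the block is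
    sorted it is inserted by [pr_insertL].  The subtraction [n - b] truncates
    harmlessly since the binomial vanishes for [n < b]. *)
Lemma pr_block k t m y n b H : measurable H ->
  determined [set v | t + n%:Z <= v] H ->
  pr (left_wordR k t m y `&` block k t n b `&` H) =
  qbin q n b * q ^+ ((n - b) * (y + m)) *
  pr (left_wordR k (t + n%:Z) m (y + b) `&` H).
Proof.
have natS i : i%:Z + 1 = i.+1%:Z by lia.
have pr0 : pr set0 = 0 by rewrite /prob measure0.
elim: n b H => [|n IH] b H mH dH.
  rewrite block0; case: b => [|b].
    rewrite mul1r mul1r addn0 addr0; congr pr.
    by set_tauto.
  rewrite !mul0r (_ : _ `&` _ `&` H = set0)//.
  by apply/seteqP; split=> // s [[_ /=]].
have IHL : pr (left_wordR k t m y `&` block k t n b `&` (readsL (t + n%:Z) `&` H)) =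
    qbin q n b * q ^+ ((n - b) * (y + m)) * q ^+ (y + b + m) *
    pr (left_wordR k (t + n.+1%:Z) m (y + b) `&` H).
  rewrite IH; last 2 first.
  - by apply: measurableI => //; exact: measurable_readsL.
  - by apply: (determined_and_next (X := fun p => p <= 0)); rewrite -addrA natS.
  rewrite setIA pr_insertL//; last by apply: determinedS dH => v /=; lia.
  by rewrite -[n.+1]addn1 PoszD addrA; ring.
(* The new L passes the b letters R of the block in addition to the y + m
   letters before it: the extra q^b is the one in the recursion of [qbin]. *)
have eL : qbin q n b * q ^+ ((n - b) * (y + m)) * q ^+ (y + b + m) =
    q ^+ b * qbin q n b * q ^+ ((n.+1 - b) * (y + m)).
  have [nb|bn] := ltnP n b; first by rewrite qbin_small// !(mul0r, mulr0).
  rewrite -mulrA -exprD [q ^+ b * _]mulrC -mulrA -exprD; congr (_ * q ^+ _).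
  by rewrite subSn//; lia.
rewrite eL in IHL.
case: b => [|b] in IHL eL *.
  rewrite (_ : _ `&` _ `&` H =
      left_wordR k t m y `&` block k t n 0 `&` (readsL (t + n%:Z) `&` H)).
    rewrite IHL mul1r; congr (_ * _ * _).
    by case: (n).
  by apply/seteqP; split=> s /=; rewrite blockS /=;
     [move=> [[? [[]|[]]]]//|tauto].
rewrite (_ : _ `&` _ `&` H =
   (left_wordR k t m y `&` block k t n b.+1 `&` (readsL (t + n%:Z) `&` H)) `|`
   (left_wordR k t m y `&` block k t n b `&` (readsR k (t + n%:Z) `&` H))); last first.
  apply/seteqP; split=> s /=; rewrite blockS /=.
    by move=> [[? [[]|[b' [<-] []]]]]; tauto.
  move=> [[[? ?] [? ?]]|[[? ?] [? ?]]]; (split=> //; split=> //); first by left.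
  by right; exists b.
rewrite probU; last 3 first.
- by measure_tac.
- by measure_tac.
- apply/seteqP; split=> // s [[_ [/= l _]] [_ [/= r _]]].
  by rewrite /readsL /readsR /= in l r; lia.
rewrite IHL IH; last 2 first.
- by apply: measurableI => //; exact: measurable_readsR.
- by apply: (determined_and_next (X := fun p => k%:Z < p)); rewrite -addrA natS.
rewrite subSS setIA [in X in _ = _ * X]addnS /=.
rewrite (_ : t + n.+1%:Z - 1 = t + n%:Z); last lia.
rewrite addnS /= (_ : t + n.+1%:Z - 1 = t + n%:Z); last lia.
by ring.
Qed.

End moves.

(** * Gaussian binomials and their limits *)
Section qfactorial.
Variables (R : realType) (q : R).
Hypotheses (q0 : 0 < q) (q1 : q < 1).

Lemma qbinSS n b :
  qbin q n.+1 b.+1 = qbin q n b + q ^+ b.+1 * qbin q n b.+1.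
Proof. by []. Qed.

Lemma qprodS n : qprod q n.+1 = qprod q n * (1 - q ^+ n.+1).
Proof. by rewrite /qprod big_nat_recr. Qed.

Lemma qprod_gt0 n : 0 < qprod q n.
Proof.
elim: n => [|n IH]; first by rewrite /qprod big_nil.
by rewrite qprodS mulr_gt0// subr_gt0 exprn_ilt1// ltW.
Qed.

Lemma qprod_neq0 n : qprod q n != 0.
Proof. by rewrite gt_eqF// qprod_gt0. Qed.

Lemma qbin_qprod a b : qbin q (a + b) b * (qprod q a * qprod q b) = qprod q (a + b).
Proof.
have qp0 : qprod q 0 = 1 by rewrite /qprod big_nil.
have [n] := ubnP (a + b); elim: n a b => // n IH [|a] [|b] hn.
- by rewrite qp0 !mulr1.
- rewrite add0n /= (qbin_small q (leqnn _)) mulr0 addr0 qp0 mul1r qprodS.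
  have := IH 0%N b; by rewrite add0n qp0 mul1r mulrA => ->//; lia.
- by rewrite addn0 /= qp0 mul1r mulr1.
- rewrite addSn qbinSS mulrDl.
  have := IH a.+1 b ltac:(lia); have := IH a b.+1 ltac:(lia).
  rewrite addSnnS; set n' := (a + b.+1)%N => e2 e1.
  transitivity (qprod q n' * (1 - q ^+ b.+1) +
                q ^+ b.+1 * (qprod q n' * (1 - q ^+ a.+1))).
    by rewrite -[X in _ = X * _ + _]e1 -[X in _ = _ + _ * (X * _)]e2 !qprodS; ring.
  rewrite qprodS (_ : n'.+1 = a.+1 + b.+1)%N; last by rewrite /n'; lia.
  by rewrite exprD; ring.
Qed.

(** The ratio is a product of a factors, each tending to 1. *)
Lemma qprod_ratio_cvg a : (fun N => qprod q (N + a) / qprod q N) @ \oo --> (1 : R).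
Proof.
elim: a => [|a IH].
  rewrite (_ : (fun _ => _) = cst 1); first exact: cvg_cst.
  by apply/funext => N; rewrite addn0 divff ?qprod_neq0.
rewrite (_ : (fun _ => _) =
    (fun N => qprod q (N + a) / qprod q N * (1 - q ^+ (N + a.+1)))); last first.
  by apply/funext => N; rewrite addnS qprodS mulrAC.
rewrite -[X in _ --> X]mulr1; apply: cvgM => //.
rewrite -[X in _ --> X]subr0; apply: cvgB; first exact: cvg_cst.
have := @cvg_expr R q; rewrite gtr0_norm// => /(_ q1).
by rewrite -(cvg_shiftn a.+1).
Qed.

Lemma qbin_cvg a : (fun N => qbin q (N + a) N) @ \oo --> (qprod q a)^-1.
Proof.
rewrite (_ : (fun _ => _) = (fun N => (qprod q a)^-1 * (qprod q (N + a) / qprod q N))).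
  by rewrite -[X in _ --> X]mulr1; apply: cvgM;
    [exact: cvg_cst|exact: qprod_ratio_cvg].
apply/funext => N; rewrite -[in RHS](addnC a) -(qbin_qprod a N) [(a + N)%N]addnC.
by field; rewrite !qprod_neq0.
Qed.

Lemma qbin_cvg_top a : (fun N => qbin q (N + a) a) @ \oo --> (qprod q a)^-1.
Proof.
rewrite (_ : (fun _ => _) = (fun N => qbin q (N + a) N)); first exact: qbin_cvg.
apply/funext => N; apply/eqP.
rewrite -(inj_eq (mulIf (qprod_neq0 a))) -(inj_eq (mulIf (qprod_neq0 N))).
have := qbin_qprod N a; have := qbin_qprod a N; rewrite addnC => e1 e2.
by rewrite -!mulrA e1 [X in _ * X]mulrC e2.
Qed.

End qfactorial.

(** * The two infinite gaps *)

(** The windows have length N + b, so that each of them holds N letters L and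
    the union is increasing. *)
Definition first_block (k : nat) (t : int) (b : nat) : set permZ :=
  \bigcup_N (left_word (t - (N + b)%:Z) 0 `&` block k (t - (N + b)%:Z) (N + b) b).

(** Each window holds N letters R, so that a counts the letters L of the whole
    half-line. *)
Definition last_block (k : nat) (t : int) (a : nat) : set permZ :=
  \bigcup_N (block k t (N + a) N `&` right_tail k (t + (N + a)%:Z)).

Lemma block_consL k t n b s : block k t n b s -> pos s (t - 1) <= 0 ->
  block k (t - 1) n.+1 b s.
Proof.
move=> [h1 <-] l; have E i : t - 1 + i.+1%:Z = t + i%:Z by lia.
split=> [[|i]|].
- by rewrite addr0 => _; left.
- by rewrite ltnS E; exact: h1.
- rewrite big_nat_recl//= addr0 (_ : (k%:Z < pos s (t - 1)) = false); last lia.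
  by rewrite add0n; apply: eq_bigr => i _; rewrite E.
Qed.

Lemma first_block_nd k t b :
  nondecreasing_seq (fun N => left_word (t - (N + b)%:Z) 0 `&` block k (t - (N + b)%:Z) (N + b) b).
Proof.
apply/nondecreasing_seqP => N; apply/subsetPset => s [/= h1 h2].
rewrite addSn (_ : t - (N + b).+1%:Z = t - (N + b)%:Z - 1); last lia.
split=> [v /= vt|]; first by apply: h1; lia.
by apply: block_consL => //; apply: h1; lia.
Qed.

Lemma last_block_nd k t a :
  nondecreasing_seq (fun N => block k t (N + a) N `&` right_tail k (t + (N + a)%:Z)).
Proof.
apply/nondecreasing_seqP => N; apply/subsetPset => s [h1 h2].
rewrite addSn; split; last by move=> v vt; apply: h2; lia.
apply/blockS; right; exists N => //; split => //=.
by apply: h2 => /=; lia.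
Qed.

(** Trailing letters R merge into an infinite tail of R. *)
Lemma left_wordR_tail k t m y :
  left_wordR k t m y `&` right_tail k t = left_word (t - y%:Z) m `&` right_tail k (t - y%:Z).
Proof.
elim: y t => [|y IH] t /=; first by rewrite subr0.
rewrite (_ : t - y.+1%:Z = t - 1 - y%:Z); last lia.
rewrite -IH; apply/seteqP; split=> s /=.
  move=> [[h1 h2] h3]; split=> // v vt.
  have [vlt|vge] := ltP v t; last exact: h3.
  by have -> : v = t - 1 by lia.
by move=> [h1 h2]; split; [split=> //|move=> v vt]; apply: h2; lia.
Qed.

Lemma measurable_first_block k t b : measurable (first_block k t b).
Proof. by apply: bigcupT_measurable => N; measure_tac. Qed.

Lemma measurable_last_block k t b : measurable (last_block k t b).
Proof. by apply: bigcupT_measurable => N; measure_tac. Qed.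

Lemma determined_last_block k t a : determined [set v | t <= v] (last_block k t a).
Proof.
move=> s s' ss' [N _ [h1 h2]]; exists N => //; split.
  by apply: (determined_block _ h1) => v [vt _]; exact: ss'.
by apply: (determined_right_tail _ h2) => v /= vt; apply: ss' => /=; lia.
Qed.

Section limits.
Variables (R : realType) (q : R) (Q : probability permZ R).
Hypotheses (q0 : 0 < q) (q1 : q < 1).
Hypothesis exQ : left_exchangeable q Q.
Local Notation pr := (prob Q).

Lemma pr_bigcup (F : nat -> set permZ) : (forall n, measurable (F n)) ->
  nondecreasing_seq F -> (fun n => pr (F n)) @ \oo --> pr (\bigcup_n F n).
Proof.
move=> mF ndF; apply: fine_cvg; rewrite -probE; last exact: bigcupT_measurable.
by apply: nondecreasing_cvg_mu => //; exact: bigcupT_measurable.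
Qed.

(** Over each finite window [pr_block] starts from the empty word, so that no
    power of q appears; then the window grows. *)
Lemma pr_first_block k t b H : measurable H -> determined [set v | t <= v] H ->
  pr (first_block k t b `&` H) = (qprod q b)^-1 * pr (left_wordR k t 0 b `&` H).
Proof.
move=> mH dH; rewrite /first_block setI_bigcupl.
set F := fun N => (left_word (t - (N + b)%:Z) 0 `&` block k (t - (N + b)%:Z) (N + b) b) `&` H.
have lim1 : (fun n => pr (F n)) @ \oo --> pr (\bigcup_n F n).
  apply: pr_bigcup.
    by move=> n; rewrite /F; measure_tac.
  by move=> i j ij; apply/subsetPset; apply: setSI; apply/subsetPset; exact: first_block_nd.
have lim2 : (fun n => pr (F n)) @ \oo --> (qprod q b)^-1 * pr (left_wordR k t 0 b `&` H).
  rewrite (_ : (fun _ => _) = (fun N => qbin q (N + b) b * pr (left_wordR k t 0 b `&` H))).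
    by apply: cvgM; [exact: qbin_cvg_top|exact: cvg_cst].
  apply/funext => N; rewrite /F.
  rewrite -(_ : left_wordR k (t - (N + b)%:Z) 0 0 = left_word (t - (N + b)%:Z) 0)//.
  rewrite (pr_block exQ)//; last by rewrite subrK.
  by rewrite subrK muln0 expr0 mulr1.
exact: cvg_unique lim1 lim2.
Qed.

(** The a letters L of the gap pass the y + m letters sorted before; the
    result is a completely sorted word, whose position is dictated by the
    counts. *)
Lemma pr_last_block k t m y a :
  pr (left_wordR k t m y `&` last_block k t a) =
  q ^+ (a * (y + m)) / qprod q a *
  pr (left_word (t + a%:Z - y%:Z) m `&` right_tail k (t + a%:Z - y%:Z)).
Proof.
rewrite /last_block setI_bigcupr.
set F := fun N => left_wordR k t m y `&` (block k t (N + a) N `&` right_tail k (t + (N + a)%:Z)).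
have lim1 : (fun n => pr (F n)) @ \oo --> pr (\bigcup_n F n).
  apply: pr_bigcup.
    by move=> n; rewrite /F; measure_tac.
  by move=> i j ij; apply/subsetPset; apply: setIS; apply/subsetPset; exact: last_block_nd.
set c := pr (left_word _ m `&` _).
have lim2 : (fun n => pr (F n)) @ \oo --> (qprod q a)^-1 * (q ^+ (a * (y + m)) * c).
  rewrite (_ : (fun _ => _) = (fun N => qbin q (N + a) N * (q ^+ (a * (y + m)) * c))).
    by apply: cvgM; [exact: qbin_cvg|exact: cvg_cst].
  apply/funext => N; rewrite /F setIA (pr_block exQ); last 2 first.
  - exact: measurable_right_tail.
  - exact: determined_right_tail.
  rewrite addKn left_wordR_tail (_ : t + (N + a)%:Z - (y + N)%:Z = t + a%:Z - y%:Z); last lia.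
  by rewrite mulrA.
by rewrite (cvg_unique _ lim1 lim2)//; ring.
Qed.

End limits.

(** * Balanced permutations *)
Lemma left_wordP t m s : left_word t m s <->
  (forall v, v < t - m%:Z -> pos s v <= 0) /\
  (forall v, t - m%:Z <= v -> v < t -> pos s v = v - (t - m%:Z) + 1).
Proof.
elim: m t => [|m IH] t /=.
  rewrite subr0; split=> [h|[]//]; split=> // v v1 v2; lia.
have e : t - m.+1%:Z = t - 1 - m%:Z by lia.
split=> [[/IH[h1 h2] h3]|[h1 h2]].
  split=> [v|v v1 v2]; first by rewrite e; exact: h1.
  rewrite /reads /= in h3.
  have [v3|v3] := ltP v (t - 1); first by rewrite h2//; lia.
  have -> : v = t - 1 by lia.
  by rewrite h3; lia.
split; first by apply/IH; rewrite -e; split=> // v v1 v2; apply: h2 => //; lia.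
by rewrite /reads /= h2//; lia.
Qed.

Lemma left_wordRP k t m y s : left_wordR k t m y s <->
  left_word (t - y%:Z) m s /\ forall v, t - y%:Z <= v -> v < t -> k%:Z < pos s v.
Proof.
elim: y t => [|y IH] t /=.
  by rewrite subr0; split=> [h|[]//]; split=> // v v1 v2; lia.
have e : t - y.+1%:Z = t - 1 - y%:Z by lia.
rewrite e; split=> [[/IH[h1 h2] h3]|[h1 h2]].
  split=> // v v1 v2; have [v3|v3] := ltP v (t - 1); first exact: h2.
  by have -> : v = t - 1 by lia.
split; first by apply/IH; split=> // v v1 v2; apply: h2 => //; lia.
by apply: h2; lia.
Qed.

Lemma pos_inj s u v : pos s u = pos s v -> u = v.
Proof. by move=> e; rewrite -(Defs.pinvK s u) e Defs.pinvK. Qed.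

(** A balanced permutation has finite sets of values crossing in either
    direction, and there are countably many pairs of finite sets. *)
Lemma measurable_balanced : measurable balanced.
Proof.
pose A s := [set j : int | 1 <= j /\ (s : permZ) j <= 0].
pose B s := [set j : int | j <= 0 /\ 1 <= (s : permZ) j].
pose D : set ({fset int} * {fset int})%type :=
  [set XY : ({fset int} * {fset int})%type | ([set` XY.1] #= [set` XY.2])%card].
have -> : balanced = \bigcup_(XY in D)
    ([set s | forall j, A s j <-> j \in XY.1] `&` [set s | forall j, B s j <-> j \in XY.2]).
  apply/seteqP; split=> [s [fA cAB]|s [[X Y] /= cXY [hA hB]]].
    have fB : finite_set (B s) by rewrite -(eq_finite_set cAB).
    have [X eX] := finite_fsetP.1 fA; have [Y eY] := finite_fsetP.1 fB.
    exists (X, Y); first by rewrite /D /= -eX -eY.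
    by split=> j /=; [have := congr1 (fun E => E j) eX|have := congr1 (fun E => E j) eY];
       rewrite /= => <-.
  have eA : A s = [set` X] by apply/seteqP; split=> j /hA.
  have eB : B s = [set` Y] by apply/seteqP; split=> j /hB.
  rewrite /balanced /=; rewrite -/(A s) -/(B s) eA eB; split=> //.
apply: countable_bigcup_measurable => -[X Y] _ /=.
apply: measurableI; apply: measurable_forall => j.
  exact: (measurable_eval (fun v => (1 <= j /\ v <= 0) <-> j \in X)).
exact: (measurable_eval (fun v => (j <= 0 /\ 1 <= v) <-> j \in Y)).
Qed.

Lemma finite_bound (A : set int) (f : int -> nat) : finite_set A ->
  exists N, forall j, A j -> (f j < N)%N.
Proof.
move=> /finite_fsetP[X ->]; exists (\max_(j <- X) f j).+1 => j jX.
by rewrite ltnS leq_bigmax_seq.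
Qed.

(** Finiteness of the two crossing sets says that far-away values do not cross
    from one half-line to the other. *)
Lemma balanced_tame s : balanced s -> exists N : nat,
  (forall v, v <= - N%:Z -> pos s v <= 0) /\ (forall v, N%:Z <= v -> 0 < pos s v).
Proof.
move=> [fA cAB].
have fB : finite_set [set j : int | j <= 0 /\ 1 <= s j] by rewrite -(eq_finite_set cAB).
have [N hN] := finite_bound (fun j => `|s j|%N) fA.
have [M hM] := finite_bound (fun j => `|s j|%N) fB.
exists (maxn N M).+1; split=> v hv.
  have [//|hp] := lerP (pos s v) 0.
  by have := hM (pos s v); have := hN (pos s v); rewrite /= Defs.pinvK; lia.
have [//|hp] := ltrP 0 (pos s v).
by have := hM (pos s v); have := hN (pos s v); rewrite /= Defs.pinvK; lia.
Qed.

(** The completely sorted word ...LLL 1 2 ... k RRR..., with the first R at the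
    value t. *)
Definition ground_word (k : nat) (t : int) : set permZ := left_word t k `&` right_tail k t.

(** In a sorted word crossings occur in one direction only, whereas a balanced
    permutation has as many crossings in one direction as in the other. *)
Lemma balanced_ground_word k t s : balanced s -> ground_word k t s -> t = k.+1%:Z.
Proof.
move=> [fA cAB] [/left_wordP[h1 h2] h3].
have hL v : v < t - k%:Z -> pos s v <= 0 by exact: h1.
have hR v : t - k%:Z <= v -> 0 < pos s v.
  by move=> hv; have [vt|vt] := ltP v t; [rewrite h2//; lia|have := h3 v vt; lia].
have [e|e|//] := ltgtP t k.+1%:Z.
- suff B0 : [set j : int | j <= 0 /\ 1 <= s j] = set0.
    move: cAB; rewrite B0 card_eq0 => /eqP A0.
    have : set0 (pos s 0) by rewrite -A0 /= Defs.pinvK; split=> //; rewrite -gtz0_ge1; apply: hR; lia.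
    by [].
  apply/seteqP; split=> // j [j0 sj].
  by have := hR (s j); rewrite Defs.pfunK; lia.
- suff A0 : [set j : int | 1 <= j /\ s j <= 0] = set0.
    move: cAB; rewrite A0 card_eq_sym card_eq0 => /eqP B0.
    have : set0 (pos s 1) by rewrite -B0 /= Defs.pinvK; split=> //; apply: hL; lia.
    by [].
  apply/seteqP; split=> // j [j0 sj].
  by have := hL (s j); rewrite Defs.pfunK; lia.
Qed.

(** * Existence and uniqueness of the counts *)
Lemma block_unique k t n b b' s : block k t n b s -> block k t n b' s -> b = b'.
Proof. by move=> [_ <-] [_ <-]. Qed.

(** Windows of different sizes are compared inside a common larger one, using
    monotonicity. *)
Lemma first_block_unique k t b b' s :
  first_block k t b s -> first_block k t b' s -> b = b'.
Proof.
wlog bb' : b b' / (b <= b')%N => [H f f'|].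
  by case: (leqP b b') => [|/ltnW] h; [exact: H|apply/esym; exact: H].
move=> [N _ f] [N' _ f'].
have g : block k (t - (N + N' + b')%:Z) (N + N' + b') b s.
  have /subsetPset/(_ s f)[_] := first_block_nd k t b (leq_addr (N' + (b' - b)) N).
  by rewrite (_ : N + _ + b = N + N' + b')%N//; lia.
apply: block_unique g _.
by have /subsetPset/(_ s f')[_] := first_block_nd k t b' (leq_addl N N').
Qed.

Lemma last_block_unique k t a a' s :
  last_block k t a s -> last_block k t a' s -> a = a'.
Proof.
wlog bb' : a a' / (a <= a')%N => [H f f'|].
  by case: (leqP a a') => [|/ltnW] h; [exact: H|apply/esym; exact: H].
move=> [N _ f] [N' _ f'].
have /subsetPset/(_ s f)[g _] := last_block_nd k t a (leq_addr (N' + (a' - a)) N).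
have /subsetPset/(_ s f')[g' _] := last_block_nd k t a' (leq_addl N N').
rewrite (_ : N + (N' + (a' - a)) + a = N + N' + a')%N in g; last lia.
by have := block_unique g g'; lia.
Qed.

Lemma count_le (p : nat -> bool) n : (\sum_(0 <= i < n) p i <= n)%N.
Proof.
rewrite -[X in (_ <= X)%N](subn0 n) -[X in (_ <= X)%N]muln1 -sum_nat_const_nat.
by apply: leq_sum => i _; exact: leq_b1.
Qed.

Lemma last_block_exists k t s :
  (forall v, t <= v -> pos s v <= 0 \/ k%:Z < pos s v) ->
  (exists M : int, forall v, M <= v -> k%:Z < pos s v) ->
  exists a, last_block k t a s.
Proof.
move=> h [M hM]; pose n := `|M - t|%N.
pose N := (\sum_(0 <= i < n) (k%:Z < pos s (t + i%:Z))%R)%N.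
have Nn : (N <= n)%N by exact: count_le.
exists (n - N)%N, N => //; rewrite subnKC//; split.
  by split=> // i _; apply: h; lia.
by move=> v hv; apply: hM; lia.
Qed.

Lemma first_block_exists k t s :
  (forall v, v < t -> pos s v <= 0 \/ k%:Z < pos s v) ->
  (exists M : int, forall v, v < M -> pos s v <= 0) ->
  exists b, first_block k t b s.
Proof.
move=> h [M hM]; pose n := `|M - t|%N.
pose b := (\sum_(0 <= i < n) (k%:Z < pos s (t - n%:Z + i%:Z))%R)%N.
have Nn : (b <= n)%N by exact: count_le.
exists b, (n - b)%N => //; rewrite subnK//; split.
  by move=> v hv; apply: hM; lia.
by split=> // i ni; apply: h; lia.
Qed.

(** * Summation over countably many disjoint cells *)
Section constants.
Variables (R : realType) (q : R) (Q : probability permZ R).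
Hypotheses (q0 : 0 < q) (q1 : q < 1).
Hypothesis exQ : left_exchangeable q Q.
Hypothesis balQ : Q balanced = 1%E.
Local Notation pr := (prob Q).

Lemma Q_unbalanced A : measurable A -> (forall s, balanced s -> ~ A s) -> Q A = 0%E.
Proof.
move=> mA nA; apply/eqP; rewrite eq_le measure_ge0 andbT.
have := probability_setC Q measurable_balanced.
rewrite balQ subee// => <-; apply: le_measure => //.
- by rewrite inE.
- by rewrite inE; exact: measurableC measurable_balanced.
- by move=> s As bs; exact: nA bs As.
Qed.

(** The part of A that the cells miss is unbalanced, hence null; countable
    additivity carries over to any countable index type by numbering it. *)
Lemma Q_esum (T : countType) (F : T -> set permZ) A :
  measurable A -> (forall i, measurable (F i)) -> trivIset setT F ->
  (forall i, F i `<=` A) -> A `&` balanced `<=` \bigcup_i F i ->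
  Q A = (\esum_(i in [set: T]) Q (F i))%E.
Proof.
move=> mA mF tF FA AF.
have mU : measurable (\bigcup_i F i) by exact: countable_bigcup_measurable.
have -> : Q A = Q (\bigcup_i F i).
  have -> : A = (\bigcup_i F i) `|` (A `\` \bigcup_i F i).
    by rewrite setDUK//; apply: bigcup_sub => i _; exact: FA.
  rewrite measureU//; last 2 first.
  - exact: measurableD.
  - by apply/seteqP; split=> // s [h [_ /(_ h)]].
  rewrite [X in (_ + X)%E]Q_unbalanced ?adde0//; first exact: measurableD.
  by move=> s bs [As nF]; apply: nF; exact: AF.
pose G n := if pickle_inv n is Some i then F i else set0.
have GF i : G (choice.pickle (i : T)) = F i by rewrite /G pickleK_inv.
have -> : \bigcup_i F i = \bigcup_n G n.
  apply/seteqP; split=> [s [i _ Fi]|s [n _]].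
    by exists (choice.pickle i) => //; rewrite GF.
  by rewrite /G; case: (pickle_inv n) => // i Fi; exists i.
have mG n : measurable (G n) by rewrite /G; case: (pickle_inv n).
have tG : trivIset setT G.
  move=> n n' _ _ [s []]; rewrite /G.
  case E: (pickle_inv n) => [i|]//; case E': (pickle_inv n') => [i'|]// Fi Fi'.
  have ii' : i = i' by apply: tF => //; exists s.
  by have := @pickle_invK T n; have := @pickle_invK T n'; rewrite E E' /= ii' => -> ->.
rewrite measure_bigcup// nneseries_esum; last by move=> n _; exact: measure_ge0.
rewrite (_ : [set x | _] = [set: nat]); last by apply/seteqP; split=> x //= _; rewrite inE.
transitivity (\esum_(n in @choice.pickle T @` [set: T]) Q (G n))%E.
  rewrite [RHS]esum_mkcond; apply: eq_esum => n _; case: ifPn => // nT.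
  rewrite /G; case E: (pickle_inv n) => [i|]; last by rewrite measure0.
  have := @pickle_invK T n; rewrite E /= => en; case/negP: nT.
  by rewrite inE; exists i.
rewrite (@reindex_esum R T nat [set: T] _ (@choice.pickle T)).
  by apply: eq_esum => i _; rewrite GF.
split=> [i _|x y _ _|n [i _ <-]]; [by exists i| |by exists i].
exact: (pcan_inj pickleK_inv).
Qed.

(** * The probability of the sorted word *)
Lemma pr_ground_word_shifted k t : t != k.+1%:Z -> pr (ground_word k t) = 0.
Proof.
move=> tk; rewrite /prob Q_unbalanced//.
  by apply: measurableI; [exact: measurable_left_word|exact: measurable_right_tail].
by move=> s bs fs; rewrite (balanced_ground_word bs fs) eqxx in tk.
Qed.

(** With no letters to record (k = 0) the event says that all values <= -N are
    L.  Among the cells given by the number a of further letters L, only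
    a = N yields a sorted word compatible with balancedness. *)
Lemma pr_left_word N : pr (left_word (1 - N%:Z) 0) = pr (ground_word 0 1) / qprod q N.
Proof.
set t := 1 - N%:Z; set c := pr (ground_word 0 1).
have prF a : pr (left_word t 0 `&` last_block 0 t a) =
    if a == N then c / qprod q N else 0.
  rewrite (_ : left_word t 0 = left_wordR 0 t 0 0)// (pr_last_block q0 q1 exQ) muln0 mul1r subr0.
  rewrite -/(ground_word 0 (t + a%:Z)); case: eqP => [->|aN].
    by rewrite /t subrK mulrC.
  by rewrite pr_ground_word_shifted ?mulr0// /t; lia.
apply: EFin_inj; rewrite -probE; last exact: measurable_left_word.
rewrite (Q_esum (F := fun a => left_word t 0 `&` last_block 0 t a)).
- transitivity (\esum_(a in [set N]) (pr (left_word t 0 `&` last_block 0 t a))%:E)%E.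
    rewrite [RHS]esum_mkcond; apply: eq_esum => a _; rewrite probE.
      by case: ifPn => //; rewrite notin_setE /= prF; case: eqP.
    by apply: measurableI; [exact: measurable_left_word|exact: measurable_last_block].
  rewrite esum_set1 prF eqxx// lee_fin divr_ge0//; first exact: fine_ge0.
  exact: ltW (qprod_gt0 _ _ _).
- exact: measurable_left_word.
- by move=> a; apply: measurableI; [exact: measurable_left_word|exact: measurable_last_block].
- by move=> a a' _ _ [s [[_ h] [_ h']]]; exact: last_block_unique h h'.
- by move=> a s [].
- move=> s [hs /balanced_tame[M [_ hM]]].
  have [||a ha] := @last_block_exists 0 t s; last by exists a.
    by move=> v _; case: (leP (pos s v) 0); [left|right].
  by exists M%:Z.
Qed.

End constants.

Section normalization.
Variables (R : realType) (q : R) (Q : probability permZ R).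
Hypotheses (q0 : 0 < q) (q1 : q < 1).
Hypothesis exQ : left_exchangeable q Q.
Hypothesis balQ : Q balanced = 1%E.
Local Notation pr := (prob Q).

(** The events of [pr_left_word] increase to an event containing the balanced
    permutations, so that p_N = C_0 / <N> tends to 1.  Hence C_0 is nonzero, and
    <N> = C_0 / p_N tends to C_0. *)
Lemma pr_ground_word0 : pr (ground_word 0 1) = qprod_oo q.
Proof.
pose F (N : nat) := left_word (1 - N%:Z) 0.
have mF N : measurable (F N) by exact: measurable_left_word.
have mU : measurable (\bigcup_N F N) by exact: countable_bigcup_measurable.
have U1 : pr (\bigcup_N F N) = 1.
  apply: EFin_inj; rewrite -probE//; apply/eqP; rewrite eq_le probability_le1//=.
  rewrite -balQ; apply: le_measure; rewrite ?inE//; first exact: measurable_balanced.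
  move=> s /balanced_tame[N [hN _]]; exists N.+1 => // v hv.
  by apply: hN; lia.
have lim1 : (fun N => pr (F N)) @ \oo --> (1 : R).
  rewrite -U1; apply: pr_bigcup => // i j ij; apply/subsetPset => s h v hv.
  by apply: h; lia.
have prF N : pr (F N) = pr (ground_word 0 1) / qprod q N by exact: pr_left_word.
(* Otherwise all p_N would vanish. *)
have c0 : pr (ground_word 0 1) != 0.
  apply/eqP => c0; have : (fun N => pr (F N)) @ \oo --> (0 : R).
    rewrite (_ : (fun _ => _) = cst 0); first exact: cvg_cst.
    by apply/funext => N; rewrite prF c0 mul0r.
  move=> lim0; have e : (1 : R) = 0 by exact: cvg_unique lim1 lim0.
  by move/eqP: e; rewrite oner_eq0.
apply/esym/cvg_lim => //.
rewrite (_ : qprod q = fun N => pr (ground_word 0 1) * (pr (F N))^-1).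
  rewrite -[X in _ --> X]mulr1; apply: cvgM; first exact: cvg_cst.
  by have := cvgV (oner_neq0 R) lim1; rewrite invr1; apply.
by apply/funext => N; rewrite prF; field; rewrite c0 qprod_neq0.
Qed.

(** Condition on the value r + 1 + y of the position r + 1, which is one of the
    letters R of the sorted word for r; moving it to the front of these letters
    costs q^y. *)
Lemma pr_ground_wordS r : pr (ground_word r r.+1%:Z) = pr (ground_word r.+1 r.+2%:Z) / (1 - q).
Proof.
set c := pr (ground_word r.+1 _).
pose F (y : nat) := left_wordR r.+1 (r.+1%:Z + y%:Z) r y `&` reads (r.+1%:Z + y%:Z) r.+1 `&`
  right_tail r.+1 (r.+1%:Z + y%:Z + 1).
have mF y : measurable (F y) by rewrite /F; measure_tac.
have prF y : pr (F y) = q ^+ y * c.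
  rewrite (pr_insert_letter exQ)//; last 2 first.
  - exact: measurable_right_tail.
  - exact: determined_right_tail.
  by rewrite left_wordR_tail (_ : _ - _ = r.+2%:Z)//; lia.
have FE y s : F y s -> ground_word r r.+1%:Z s /\ s r.+1%:Z = r.+1%:Z + y%:Z.
  move=> [[/left_wordRP[h1 h2] h3] h4].
  rewrite addrK in h1 h2; rewrite /reads /= in h3.
  split; last by rewrite -[X in pfun _ X]h3 Defs.pinvK.
  split=> // v /= v1; have [v2|v2] := ltP v (r.+1%:Z + y%:Z).
    by have := h2 v v1 v2; lia.
  have [->|v3] := eqVneq v (r.+1%:Z + y%:Z); first by rewrite h3; lia.
  by have := h4 v; rewrite /=; lia.
apply: EFin_inj; rewrite -probE; last first.
  by apply: measurableI; [exact: measurable_left_word|exact: measurable_right_tail].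
rewrite (Q_esum balQ (F := F))//.
- rewrite -nneseries_esumT; last by move=> n; exact: measure_ge0.
  rewrite (_ : (fun n => _) = (EFin \o series (geometric c q))).
    rewrite EFin_lim; last by apply: is_cvg_geometric_series; rewrite gtr0_norm.
    congr EFin; apply: cvg_lim => //.
    by apply: cvg_geometric_series; rewrite gtr0_norm.
  apply/funext => n /=; rewrite /series /= -sumEFin.
  by apply: eq_bigr => y _; rewrite probE// prF mulrC.
- by apply: measurableI; [exact: measurable_left_word|exact: measurable_right_tail].
- move=> y y' _ _ [s [/FE[_ e] /FE[_ e']]].
  by rewrite e in e'; lia.
- by move=> y s /FE[].
move=> s [[hi ht] _]; have /left_wordP[h1 h2] := hi.
set v := s r.+1%:Z; have pv : pos s v = r.+1%:Z by rewrite Defs.pfunK.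
have vr : r.+1%:Z <= v.
  have [//|vl] := lerP r.+1%:Z v.
  have [v1|v1] := ltP v (r.+1%:Z - r%:Z); first by have := h1 _ v1; lia.
  by have := h2 _ v1 vl; lia.
have hne u : r.+1%:Z <= u -> u != v -> r.+1%:Z < pos s u.
  move=> u1 uv; have := ht u u1; have : pos s u <> r.+1%:Z; last lia.
  by rewrite -pv => /pos_inj uv'; rewrite uv' eqxx in uv.
exists `|v - r.+1%:Z|%N => //.
have ev : r.+1%:Z + `|v - r.+1%:Z|%N%:Z = v by lia.
rewrite /F ev; split; last by move=> u /= hu; apply: hne; lia.
split=> //; apply/left_wordRP; rewrite (_ : v - _ = r.+1%:Z); last lia.
by split=> // u u1 u2; apply: hne; lia.
Qed.

Lemma pr_ground_word r : pr (ground_word r r.+1%:Z) = (1 - q) ^+ r * qprod_oo q.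
Proof.
elim: r => [|r IH]; first by rewrite mul1r; exact: pr_ground_word0.
have q1' : 1 - q != 0 by rewrite subr_eq0 gt_eqF.
by rewrite exprS -mulrA -IH [in RHS]pr_ground_wordS; field.
Qed.

(** * Prescribed displacements with prescribed counts *)

(** The part of the word below the value v m, where the letter i + 1 occurs at
    the value v i: the counts b 0, ..., b m of letters R are prescribed in the
    first m + 1 gaps, and g i is the length of the gap that follows v i. *)
Definition pattern (k : nat) (v : nat -> int) (g b : nat -> nat) (m : nat) : set permZ :=
  [set s | first_block k (v 0%N) (b 0%N) s /\ forall i, (i < m)%N ->
    reads (v i) i.+1 s /\ block k (v i + 1) (g i) (b i.+1) s].

Lemma patternS k v g b m : pattern k v g b m.+1 =
  pattern k v g b m `&` (reads (v m) m.+1 `&` block k (v m + 1) (g m) (b m.+1)).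
Proof.
apply/seteqP; split=> s [].
  move=> h1 h2; split; last exact: h2.
  by split=> // i im; apply: h2; exact: ltnW.
move=> [h1 h2] h3; split=> // i; rewrite ltnS leq_eqVlt => /orP[/eqP ->//|].
exact: h2.
Qed.

Lemma pattern0 k v g b : pattern k v g b 0 = first_block k (v 0%N) (b 0%N).
Proof. by apply/seteqP; split=> s // []. Qed.

Lemma measurable_pattern k v g b m : measurable (pattern k v g b m).
Proof.
elim: m => [|m IH]; first by rewrite pattern0; exact: measurable_first_block.
by rewrite patternS; measure_tac.
Qed.

Definition prefix_sum (b : nat -> nat) (m : nat) := (\sum_(0 <= i < m.+1) b i)%N.

(** One step sorts the letter m + 1 past the R accumulated so far and then the
    gap that follows it. *)
Lemma pr_pattern k v g b m H : (m <= k)%N ->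
  (forall i, (i < m)%N -> v i.+1 = v i + 1 + (g i)%:Z) ->
  measurable H -> determined [set u | v m <= u] H ->
  pr (pattern k v g b m `&` H) =
  (qprod q (b 0%N))^-1 * (\prod_(0 <= i < m) (qbin q (g i) (b i.+1) *
    q ^+ (prefix_sum b i + (g i - b i.+1) * (prefix_sum b i + i.+1)))) *
  pr (left_wordR k (v m) m (prefix_sum b m) `&` H).
Proof.
elim: m H => [|m IH] H mk hv mH dH.
  rewrite pattern0 (pr_first_block q0 q1 exQ)// big_geq// mulr1.
  by rewrite /prefix_sum big_nat1.
have hv' := hv m (ltnSn m).
have vlt : v m + 1 <= v m.+1 by rewrite hv'; lia.
have dB : determined [set u | v m + 1 <= u]
    (block k (v m + 1) (g m) (b m.+1) `&` H).
  apply: determinedI; first by apply: determinedS (@determined_block _ _ _ _) => u /= [].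
  by apply: determinedS dH => u /=; lia.
rewrite patternS -setIA IH//; last 4 first.
- exact: ltnW.
- by move=> i im; apply: hv; exact: ltnW.
- by measure_tac.
- rewrite -setIA; apply: determinedI; last by apply: determinedS dB => u /=; lia.
  by move=> s s' /(_ (v m)) ss'; rewrite /reads /= ss'//=.
rewrite -[in X in _ * X = _](setIA (reads _ _)) setIA (pr_insert_letter exQ)//; last by measure_tac.
rewrite setIA (pr_block exQ)//; last by rewrite -hv'.
rewrite -hv' big_nat_recr//= (_ : prefix_sum b m + b m.+1 = prefix_sum b m.+1)%N; last first.
  by rewrite /prefix_sum [in RHS]big_nat_recr.
by rewrite exprD; ring.
Qed.

(** There are k' + 1 letters.  The count a i refers to letters L in the gap
    after v i, so in a finite gap it is tied to the number of letters R; in the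
    last gap it is independent data. *)
Definition cell (k' : nat) (v : nat -> int) (g a b : nat -> nat) : set permZ :=
  [set s | (forall i, (i < k')%N -> (a i + b i.+1 = g i)%N) /\
    (pattern k'.+1 v g b k' `&` (reads (v k') k'.+1 `&`
     last_block k'.+1 (v k' + 1) (a k'))) s].

Lemma cellE k' v g a b : (forall i, (i < k')%N -> (a i + b i.+1 = g i)%N) ->
  cell k' v g a b = pattern k'.+1 v g b k' `&` (reads (v k') k'.+1 `&`
     last_block k'.+1 (v k' + 1) (a k')).
Proof. by move=> h; apply/seteqP; split=> s // []. Qed.

Lemma measurable_cell k' v g a b : measurable (cell k' v g a b).
Proof.
have [h|h] := pselect (forall i, (i < k')%N -> (a i + b i.+1 = g i)%N).
  rewrite cellE//; apply: measurableI; first exact: measurable_pattern.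
  by apply: measurableI; [exact: measurable_reads|exact: measurable_last_block].
rewrite (_ : cell _ _ _ _ _ = set0)//.
by apply/seteqP; split=> // s [/h].
Qed.

(** The Gaussian binomial of a finite gap is <g_i> / (<a_i> <b_(i+1)>); the
    infinite gaps supply the missing factors <b_0> and <a_k'>. *)
Lemma pr_cell k' v g a b :
  (forall i, (i < k')%N -> v i.+1 = v i + 1 + (g i)%:Z) ->
  (forall i, (i < k')%N -> (a i + b i.+1 = g i)%N) ->
  pr (cell k' v g a b) =
  (\prod_(0 <= i < k') qprod q (g i)) *
  q ^+ (\sum_(0 <= i < k'.+1) (prefix_sum b i + a i * (prefix_sum b i + i.+1)))%N /
  ((\prod_(0 <= i < k'.+1) qprod q (b i)) * (\prod_(0 <= i < k'.+1) qprod q (a i))) *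
  pr (ground_word k'.+1 (v k' + 1 + (a k')%:Z - (prefix_sum b k')%:Z)).
Proof.
move=> hv hg; rewrite cellE// pr_pattern//; last 2 first.
- by apply: measurableI; [exact: measurable_reads|exact: measurable_last_block].
- apply: determinedI; first by move=> s s' /(_ (v k')) ss'; rewrite /reads /= ss'//=.
  by apply: determinedS (@determined_last_block _ _ _) => u /=; lia.
rewrite setIA (pr_insert_letter exQ)//; last 2 first.
- exact: measurable_last_block.
- exact: determined_last_block.
rewrite (pr_last_block q0 q1 exQ) -/(ground_word _ _).
rewrite (eq_big_nat _ _ (F2 := fun i => qprod q (g i) * (qprod q (a i))^-1 *
   (qprod q (b i.+1))^-1 * q ^+ (prefix_sum b i + a i * (prefix_sum b i + i.+1)))); last first.
  move=> i /andP[_ ik]; rewrite -(hg i ik) addnK; congr (_ * _).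
  by rewrite -(qbin_qprod q0 q1 (a i) (b i.+1)); field; rewrite !qprod_neq0.
have eX : q ^+ (\sum_(0 <= i < k'.+1) (prefix_sum b i + a i * (prefix_sum b i + i.+1)))%N =
    (\prod_(0 <= i < k') q ^+ (prefix_sum b i + a i * (prefix_sum b i + i.+1))) *
    q ^+ prefix_sum b k' * q ^+ (a k' * (prefix_sum b k' + k'.+1)).
  by rewrite big_nat_recr//= !exprD expr_sum mulrA.
rewrite eX !big_split/= !prodfV [X in _ / (X * _)]big_nat_recl//.
rewrite [X in _ / (_ * X)]big_nat_recr//=.
have p0 (f : nat -> nat) : \prod_(0 <= i < k') qprod q (f i) != 0.
  by rewrite prodf_seq_neq0; apply/allP => i _; rewrite qprod_neq0.
field; rewrite !p0 !qprod_neq0//.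
Qed.

End normalization.

(** * Sums and families indexed by ordinals *)

(** Scaling each finite partial sum gives one inequality; the other is the same
    inequality for the inverse scalar. *)
Lemma esumZ (R : realType) (T : choiceType) (D : set T) (c : R) (f : T -> \bar R) :
  0 <= c -> (forall i, (0 <= f i)%E) ->
  (\esum_(i in D) (c%:E * f i) = c%:E * \esum_(i in D) f i)%E.
Proof.
move=> c0 f0.
have le (x : R) (h : T -> \bar R) : 0 <= x -> (forall i, (0 <= h i)%E) ->
    (\esum_(i in D) (x%:E * h i) <= x%:E * \esum_(i in D) h i)%E.
  move=> x0 h0; apply: ge_ereal_sup => _ [F [finF FD] <-].
  rewrite -ge0_mule_fsumr//; apply: lee_wpmul2l; first by rewrite lee_fin.
  by apply: ereal_sup_ubound; exists F.
have [->|cn0] := eqVneq c 0.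
  by rewrite mul0e esum1// => i _; rewrite mul0e.
apply/eqP; rewrite eq_le le//=.
have -> : f = (fun i => (c^-1)%:E * (c%:E * f i))%E.
  by apply/funext => i; rewrite muleA -EFinM mulVf// mul1e.
apply: (@le_trans _ _ (c%:E * ((c^-1)%:E * \esum_(i in D) (c%:E * f i))))%E.
  apply: lee_wpmul2l; first by rewrite lee_fin.
  by apply: le; [rewrite invr_ge0|move=> i; apply: mule_ge0].
rewrite muleA -EFinM divff// mul1e; apply: le_esum => i _.
by rewrite [X in (_ <= _ * X)%E]muleA -EFinM mulVf// mul1e.
Qed.

Lemma sum_succ n : (\sum_(0 <= i < n) i.+1)%N = ((n * n.+1) %/ 2)%N.
Proof.
rewrite (_ : n * n.+1 = (\sum_(0 <= i < n) i.+1) * 2)%N ?mulnK//.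
elim: n => [|n IH]; first by rewrite big_nil.
by rewrite big_nat_recr//= mulnDl -IH; lia.
Qed.

Section indices.
Variable (k : nat).
Implicit Types a b : {ffun 'I_k.+1 -> nat}.

(** Recursion along the gaps wants families indexed by naturals. *)
Definition at_nat (T : Type) (f : 'I_k.+1 -> T) (i : nat) : T := f (inord i).

Lemma at_natE T (f : 'I_k.+1 -> T) (i : 'I_k.+1) : at_nat f i = f i.
Proof. by rewrite /at_nat inord_val. Qed.

Lemma prefix_sum_ord b m : (m <= k)%N ->
  (\sum_(i < k.+1 | (i <= m)%N) b i)%N = prefix_sum (at_nat b) m.
Proof.
move=> mk; rewrite /prefix_sum big_mkord (big_ord_widen k.+1 (at_nat b))//.
by apply: eq_bigr => i _; rewrite at_natE.
Qed.

Lemma tail_sum_ord a m :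
  (\sum_(i < k.+1 | (m <= i)%N) a i)%N = (\sum_(m <= i < k.+1) at_nat a i)%N.
Proof.
by rewrite big_geq_mkord; apply: eq_bigr => i _; rewrite at_natE.
Qed.

(** Expand each product as a sum over i <= j and collect the terms with a fixed
    j; the constant terms add up to the triangular number that the prefactor of
    the theorem removes. *)
Lemma exponentE a b :
  (\sum_(i < k.+1) \sum_(j < k.+1 | (i <= j)%N) (b i).+1 * (a j).+1)%N =
  (\sum_(0 <= i < k.+1) (prefix_sum (at_nat b) i + at_nat a i * (prefix_sum (at_nat b) i + i.+1)) +
   (k.+1 * k.+2) %/ 2)%N.
Proof.
rewrite (exchange_big_dep predT)//= -sum_succ -big_split/= big_mkord.
apply: eq_bigr => j _; rewrite -big_distrl/= at_natE.
have -> : (\sum_(i < k.+1 | (i <= j)%N) (b i).+1 = prefix_sum (at_nat b) j + j.+1)%N.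
  under eq_bigr do rewrite -addn1.
  rewrite big_split/= prefix_sum_ord; last by rewrite -ltnS.
  congr (_ + _)%N; transitivity (\sum_(i < j.+1) 1)%N.
    by rewrite (big_ord_widen k.+1 (fun=> 1%N)).
  by rewrite sum_nat_const card_ord muln1.
by lia.
Qed.

Lemma gap_prodE (R : realType) (q : R) (d : 'I_k.+1 -> int) :
  gap_prod q d =
  \prod_(0 <= i < k) qprod q `|at_nat d i.+1 - at_nat d i|%N.
Proof.
rewrite /gap_prod big_ord_recl [X in X * _]big_pred0// mul1r big_mkord; apply: eq_bigr => i _.
rewrite (big_pred1 (inord i)) => [|l] /=.
  by rewrite /at_nat (_ : inord i.+1 = lift ord0 i)//; apply/val_inj; rewrite /= inordK// ltnS.
by rewrite /bump/= add1n eqSS -val_eqE /= inordK 1?eq_sym// ltnS ltnW.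
Qed.

(** Consecutive constraints differ by the count of a finite gap, so the system
    amounts to all the gap counts together with its last equation. *)
Lemma constraintP (d : 'I_k.+1 -> int)
    (hd : forall i j : 'I_k.+1, (i <= j)%N -> d i <= d j) a b :
  constraint d (a, b) <->
  (forall i, (i < k)%N ->
     at_nat a i + at_nat b i.+1 = `|at_nat d i.+1 - at_nat d i|)%N /\
  (prefix_sum (at_nat b) k)%:Z - (at_nat a k)%:Z = at_nat d k.
Proof.
set A := at_nat a; set B := at_nat b; set D := at_nat d.
have hD i : (i < k)%N -> D i <= D i.+1.
  by move=> ik; apply: hd; rewrite !inordK//; lia.
pose c m : int := (prefix_sum B m)%:Z - (\sum_(m <= i < k.+1) A i)%N%:Z.
have cS m : (m < k)%N -> c m.+1 = c m + (A m + B m.+1)%N%:Z.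
  move=> mk; rewrite /c /prefix_sum big_nat_recr//= [in RHS](@big_ltn _ _ _ m)//; last lia.
  by lia.
have ck : c k = (prefix_sum B k)%:Z - (A k)%:Z by rewrite /c big_nat1.
have -> : constraint d (a, b) <-> forall m, (m <= k)%N -> c m = D m.
  split=> [h m mk|h m].
    by have := h (inord m); rewrite /= inordK// prefix_sum_ord// tail_sum_ord.
  have mk : (m <= k)%N by rewrite -ltnS.
  by rewrite prefix_sum_ord// tail_sum_ord -/(c m) h// /D at_natE.
rewrite -ck; split=> [h|[h1 h2]].
  split=> [i ik|]; last exact: h.
  have := cS i ik; rewrite !h//; last exact: ltnW.
  by lia.
move=> m mk; rewrite -(subKn mk); elim: (k - m)%N => [|j IH]; first by rewrite subn0.
have [jk|jk] := ltnP j k; last by rewrite (_ : k - j.+1 = k - j)%N//; lia.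
have e : (k - j = (k - j.+1).+1)%N by lia.
have lk : (k - j.+1 < k)%N by lia.
rewrite e cS// h1// in IH.
by have := hD _ lk; lia.
Qed.

End indices.

(** * The joint law of the displacements *)
Section law.
Variables (R : realType) (q : R) (Q : probability permZ R).
Hypotheses (q0 : 0 < q) (q1 : q < 1).
Hypothesis exQ : left_exchangeable q Q.
Hypothesis balQ : Q balanced = 1%E.
Variables (k : nat) (d : 'I_k.+1 -> int).
Hypothesis hd : forall i j : 'I_k.+1, (i <= j)%N -> d i <= d j.

Let D := at_nat d.
Let v (i : nat) : int := i.+1%:Z + D i.
Let g (i : nat) : nat := `|D i.+1 - D i|%N.
Let C (ab : {ffun 'I_k.+1 -> nat} * {ffun 'I_k.+1 -> nat}) :=
  cell k v g (at_nat ab.1) (at_nat ab.2).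

Let hD i j : (i <= j)%N -> (j <= k)%N -> D i <= D j.
Proof. by move=> ij jk; apply: hd; rewrite !inordK//; lia. Qed.

Let vS i : (i < k)%N -> v i.+1 = v i + 1 + (g i)%:Z.
Proof. by move=> ik; have := hD (leqnSn i) ik; rewrite /v /g; lia. Qed.

Let v_mono i j : (i <= j)%N -> (j <= k)%N -> v i <= v j.
Proof. by move=> ij jk; have := hD ij jk; rewrite /v; lia. Qed.

(** The gap counts are part of the definition of a cell, and the last
    constraint says that its sorted word starts where balancedness wants it. *)
Lemma Q_cell ab : Q (C ab) =
  if ab \in constraint d
  then (((1 - q) ^+ k.+1 * q ^- ((k.+1 * k.+2) %/ 2)%N * qprod_oo q * gap_prod q d)%:E *
        (summand q ab)%:E)%E
  else 0%E.
Proof.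
rewrite probE; last exact: measurable_cell.
case: ab => a b; rewrite /C /=.
have [gapP|ngap] :=
  pselect (forall i, (i < k)%N -> (at_nat a i + at_nat b i.+1 = g i)%N); last first.
  rewrite (_ : cell _ _ _ _ _ = set0).
    rewrite /prob measure0/=; case: ifPn => // /set_mem /(constraintP hd)[h _].
    by case: ngap.
  by apply/seteqP; split=> // s [/ngap].
rewrite (pr_cell q0 q1 exQ)//.
have e : (v k + 1 + (at_nat a k)%:Z - (prefix_sum (at_nat b) k)%:Z == k.+2%:Z) =
    ((a, b) \in constraint d).
  apply/eqP/idP => [h|/set_mem /(constraintP hd)[_]]; last by rewrite /v /D; lia.
  by rewrite inE; apply/(constraintP hd); split=> //; move: h; rewrite /v /D; lia.
rewrite -e; case: eqP => [->|/eqP ne]; last by rewrite (pr_ground_word_shifted balQ)// mulr0.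
rewrite (pr_ground_word q0 q1 exQ balQ) -EFinM; congr EFin.
rewrite /summand /= exponentE gap_prodE exprD -/g.
rewrite [in RHS](eq_bigr (fun i : 'I_k.+1 => qprod q (at_nat b i))); last first.
  by move=> i _; rewrite at_natE.
rewrite [X in _ = _ * (_ / (_ * X))](eq_bigr (fun i : 'I_k.+1 => qprod q (at_nat a i)));
  last by move=> i _; rewrite at_natE.
rewrite -!(big_mkord xpredT (fun i => qprod q (at_nat _ i))).
have p0 n (f : nat -> nat) : \prod_(0 <= i < n) qprod q (f i) != 0.
  by rewrite prodf_seq_neq0; apply/allP => i _; rewrite qprod_neq0.
have qn0 n : q ^+ n != 0 by rewrite expf_neq0// gt_eqF.
by field; rewrite !p0 qn0.
Qed.

Let E := [set s : permZ | forall m : 'I_k.+1, displacement s (m.+1)%:Z = d m].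

Let EP s : E s <-> forall i, (i <= k)%N -> pos s (v i) = i.+1%:Z.
Proof.
split=> [h i ik|h m].
  have := h (inord i); rewrite inordK// /displacement => e.
  rewrite (_ : v i = s i.+1%:Z) ?Defs.pfunK//.
  by rewrite /v /D /at_nat -e; lia.
have mk : (m <= k)%N by rewrite -ltnS.
rewrite /displacement -(h _ mk) Defs.pinvK h// /v /D at_natE; lia.
Qed.

Lemma trivIset_cell : trivIset setT C.
Proof.
move=> [a b] [a' b'] _ _ [s [[/= g1 [[f1 p1] [_ l1]]] [/= g2 [[f2 p2] [_ l2]]]]].
have eb i : (i <= k)%N -> at_nat b i = at_nat b' i.
  case: i => [|i] ik; first exact: first_block_unique f1 f2.
  exact: block_unique (p1 i ik).2 (p2 i ik).2.
have ea i : (i <= k)%N -> at_nat a i = at_nat a' i.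
  rewrite leq_eqVlt => /orP[/eqP ->|ik]; first exact: last_block_unique l1 l2.
  by have := eb i.+1 ik; have := g1 i ik; have := g2 i ik; lia.
have -> : a = a' by apply/ffunP => i; rewrite -(at_natE a) -(at_natE a') ea// -ltnS.
by have -> : b = b' by apply/ffunP => i; rewrite -(at_natE b) -(at_natE b') eb// -ltnS.
Qed.

(** The letters of E occupy the values v i, so every other value reads L or R;
    tameness makes the two infinite gaps have finite counts. *)
Lemma cell_cover : E `&` balanced `<=` \bigcup_ab C ab.
Proof.
move=> s [/EP hE /balanced_tame[N [hN hN']]].
have free u : (forall i, (i <= k)%N -> u != v i) -> pos s u <= 0 \/ k.+1%:Z < pos s u.
  move=> hu; have [|p0] := lerP (pos s u) 0; first by left.
  have [|pk] := ltrP k.+1%:Z (pos s u); first by right.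
  have ik : (`|pos s u|.-1 <= k)%N by lia.
  have : pos s u = pos s (v `|pos s u|.-1) by rewrite hE//; lia.
  by move/pos_inj => e; have := hu _ ik; rewrite -e eqxx.
have [||b0 hb0] := @first_block_exists k.+1 (v 0%N) s.
- by move=> u hu; apply: free => i ik; have := v_mono (leq0n i) ik; lia.
- by exists (- N%:Z) => u hu; apply: hN; lia.
have [||a0 ha0] := @last_block_exists k.+1 (v k + 1) s.
- by move=> u hu; apply: free => i ik; have := v_mono ik (leqnn k); lia.
- exists (Num.max N%:Z (v k + 1)) => u; rewrite ge_max => /andP[u1 u2].
  have [i ik|p0|//] := free u; last by have := hN' u u1; lia.
  by have := v_mono ik (leqnn k); lia.
pose cnt i := (\sum_(0 <= j < g i) (k.+1%:Z < pos s (v i + 1 + j%:Z))%R)%N.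
have cnt_le i : (cnt i <= g i)%N by exact: count_le.
pose b : {ffun 'I_k.+1 -> nat} := [ffun i : 'I_k.+1 => if val i is j.+1 then cnt j else b0].
pose a : {ffun 'I_k.+1 -> nat} := [ffun i : 'I_k.+1 => if (i < k)%N then (g i - cnt i)%N else a0].
have bE i : (i <= k)%N -> at_nat b i = if i is j.+1 then cnt j else b0.
  by move=> ik; rewrite /at_nat ffunE /= inordK.
have aE i : (i <= k)%N -> at_nat a i = if (i < k)%N then (g i - cnt i)%N else a0.
  by move=> ik; rewrite /at_nat ffunE /= inordK.
exists (a, b) => //; split=> [i ik|] /=.
  by rewrite (aE _ (ltnW ik)) bE// ik subnK.
split; last first.
  by rewrite aE// ltnn; split=> //; exact: hE.
split; first by rewrite bE.
move=> i ik; split; first by apply: hE; exact: ltnW.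
rewrite bE//; split=> // j jg; apply: free => l lk.
have [li|il] := leqP l i; first by have := v_mono li (ltnW ik); lia.
by have := v_mono il lk; have := vS ik; lia.
Qed.

Lemma Q_displacements : Q E =
  (((1 - q) ^+ k.+1 * q ^- ((k.+1 * k.+2) %/ 2)%N * qprod_oo q * gap_prod q d)%:E *
   \esum_(ab in constraint d) (summand q ab)%:E)%E.
Proof.
have qoo0 : 0 <= qprod_oo q.
  by rewrite -(pr_ground_word0 q0 q1 exQ balQ) fine_ge0.
have mE : measurable E.
  rewrite (_ : E = [set s | forall i : 'I_k.+1, reads (v i) i.+1 s]).
    by apply: measurable_forall => i; exact: measurable_reads.
  apply/seteqP; split=> s; rewrite EP => h i; first by apply: h; rewrite -ltnS.
  by rewrite -ltnS => ik; exact: (h (Ordinal ik)).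
rewrite (Q_esum balQ (F := C))//; last first.
- exact: cell_cover.
- move=> ab s [_ [[_ h1] [h2 _]]]; apply/EP => i.
  by rewrite leq_eqVlt => /orP[/eqP ->//|ik]; exact: (h1 i ik).1.
- exact: trivIset_cell.
- by move=> ab; exact: measurable_cell.
rewrite -esumZ; last 2 first.
- rewrite !mulr_ge0//.
  + by rewrite exprn_ge0// subr_ge0 ltW.
  + by rewrite invr_ge0 exprn_ge0// ltW.
  + by rewrite gap_prodE prodr_ge0// => i _; rewrite ltW// qprod_gt0.
- move=> ab; rewrite lee_fin divr_ge0// ?exprn_ge0// ?ltW//.
  by rewrite mulr_gt0// prodr_gt0// => i _; exact: qprod_gt0.
by rewrite [RHS]esum_mkcond; apply: eq_esum => ab _; rewrite Q_cell.
Qed.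

End law.

Theorem theorem6p1 (R : realType) (q : R) (hq0 : 0 < q) (hq1 : q < 1)
    (disp : measure_display) (Omega : measurableType disp)
    (P : probability Omega R)
    (Sigma : {mfun Omega >-> permZ})
    (hSigma : Mallows q (distribution P Sigma))
    (k : nat) (hk : (0 < k)%N) (d : 'I_k -> int)
    (hd : forall i j : 'I_k, (i <= j)%N -> d i <= d j) :
  (P [set w | forall m : 'I_k, displacement (Sigma w) (m.+1)%:Z = d m] =
   ((1 - q) ^+ k * q ^- ((k * k.+1) %/ 2)%N * qprod_oo q * gap_prod q d)%:E *
   \esum_(ab in constraint d) (summand q ab)%:E)%E.
Proof.
have [balQ _ exQ] := hSigma.
case: k hk d hd => // k _ d hd.
exact: (Q_displacements hq0 hq1 exQ balQ hd).
Qed.
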